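(* Let $L$ be a finite-dimensional solvable Leibniz algebra over any field $F$. Then $L$ is dually atomistic if and only if one of the following conditions holds: (i) $L$ is an abelian or almost abelian Lie algebra; (ii) $L=\mathrm{Leib}(L)\dot{+}Fv$ (vector space direct sum), where $v^2=0$ and $[e,v]=e$ for every $e\in\mathrm{Leib}(L)$.
   Context: A (right) Leibniz algebra over a field $F$ is an $F$-vector space $L$ with a bilinear product $[\cdot,\cdot]$ satisfying $[x,[y,z]]=[[x,y],z]-[[x,z],y]$ for all $x,y,z\in L$; write $x^2=[x,x]$. The Leibniz kernel is $\mathrm{Leib}(L)=\mathrm{span}\{x^2\mid x\in L\}$; it is an ideal and $[L,\mathrm{Leib}(L)]=0$. $L$ is solvable if $L^{(n)}=0$ for some $n$, where $L^{(0)}=L$, $L^{(k+1)}=[L^{(k)},L^{(k)}]$. $L$ is dually atomistic if every subalgebra of $L$ is an intersection of maximal subalgebras of $L$ (with $L$ itself being the empty intersection). A Lie algebra $L$ is almost abelian if $L=A\dot{+}Fv$ with $A$ an abelian ideal and $[a,v]=a$ for all $a\in A$. *)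

(* Defs.v *)
From mathcomp Require Import all_boot all_order all_algebra.
From mathcomp Require Import all_classical.

Set Implicit Arguments.
Unset Strict Implicit.
Unset Printing Implicit Defensive.

Import GRing.Theory.
Local Open Scope classical_set_scope.
Local Open Scope ring_scope.

Section SpanOfSet.
Variables (F : fieldType) (V : vectType F).
Implicit Types (A : set V) (U : {vspace V}).

(* The library only spans finite sequences; spanset_min and spansetP show that
   this is the linear span of an arbitrary set. *)
Definition spanset A : {vspace V} :=
  xget 0%VS [set U : {vspace V} | (forall x, A x -> x \in U) /\
                     (forall W : {vspace V},
                        (forall x, A x -> x \in W) -> (U <= W)%VS)].

Lemma spanset_seq A :
  exists s : seq V, (forall x, x \in s -> A x) /\ (forall x, A x -> x \in <<s>>%VS).
Proof.
pose P n := `[< exists s : seq V, (forall x, x \in s -> A x) /\ \dim <<s>> = n >].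
have exP : exists n, P n by exists (\dim <<[::] : seq V>>); apply/asboolP; exists [::].
have ubP n : P n -> (n <= \dim {:V})%N.
  by move=> /asboolP[s [_ <-]]; exact/dimvS/subvf.
case: (ex_maxnP exP ubP) => n /asboolP[s [sA ds]] maxn.
exists s; split=> // x Ax.
have sub : (<<s>> <= <<x :: s>>)%VS by rewrite span_cons addvSr.
have /eqP -> : <<s>>%VS == <<x :: s>>%VS.
  rewrite -dimv_leqif_eq // eqn_leq dimvS //= ds; apply: maxn.
  apply/asboolP; exists (x :: s); split=> // y.
  by rewrite inE => /predU1P[-> //|]; exact: sA.
by apply: memv_span; rewrite mem_head.
Qed.

Lemma spanset_spec A :
  (forall x, A x -> x \in spanset A) /\
  (forall W : {vspace V}, (forall x, A x -> x \in W) -> (spanset A <= W)%VS).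
Proof.
rewrite /spanset; set P := (X in xget _ X).
apply: (@xgetPex _ _ P); have [s [sA As]] := spanset_seq A.
by exists <<s>>%VS; split=> // W AW; apply/span_subvP => x /sA; exact: AW.
Qed.

Lemma mem_spanset A x : A x -> x \in spanset A.
Proof. exact: (spanset_spec A).1. Qed.

Lemma spanset_min A (W : {vspace V}) : (forall x, A x -> x \in W) -> (spanset A <= W)%VS.
Proof. exact: (spanset_spec A).2. Qed.

Lemma spansetP A x :
  x \in spanset A <->
  exists s : seq V, (forall y, y \in s -> A y) /\ x \in <<s>>%VS.
Proof.
split=> [xA|[s [sA]]]; last first.
  by apply/subvP/span_subvP => y /sA; exact: mem_spanset.
have [s [sA As]] := spanset_seq A.
by exists s; split=> //; apply: (subvP (spanset_min As)).
Qed.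

End SpanOfSet.

Section LeibnizAlgebras.
Variables (F : fieldType) (L : vectType F).
Variable br : {bilinear L -> L -> L}.
Implicit Types (U W S M A : {vspace L}).

Definition leibniz_algebra : Prop :=
  forall x y z, br x (br y z) = br (br x y) z - br (br x z) y.

Definition lie_algebra : Prop :=
  (forall x, br x x = 0) /\
  (forall x y z, br x (br y z) + br y (br z x) + br z (br x y) = 0).

Definition abelian_algebra : Prop := forall x y, br x y = 0.

Definition Leib : {vspace L} := spanset [set br x x | x in [set: L]].

Definition brv U W : {vspace L} := spanset [set br x y | x in [set` U] & y in [set` W]].

Fixpoint derived_series (n : nat) : {vspace L} :=
  if n is k.+1 then brv (derived_series k) (derived_series k) else fullv.

Definition solvable_algebra : Prop := exists n, derived_series n = 0%VS.

Definition subalgebra S : Prop :=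
  forall x y, x \in S -> y \in S -> br x y \in S.

Definition ideal A : Prop :=
  forall x a, a \in A -> br a x \in A /\ br x a \in A.

Definition maximal_subalgebra M : Prop :=
  [/\ subalgebra M, M <> fullv &
      forall S, subalgebra S -> (M <= S)%VS -> S = M \/ S = fullv].

(* The family C may be infinite, and the intersection of the empty family is
   the whole of L. *)
Definition dually_atomistic : Prop :=
  forall S, subalgebra S ->
  exists C : set {vspace L},
    (forall M, C M -> maximal_subalgebra M) /\
    [set` S] = \bigcap_(M in C) [set` M].

Definition direct_decomposition U W : Prop :=
  (U + W)%VS = fullv /\ directv (U + W).

Definition almost_abelian : Prop :=
  exists A v,
    [/\ direct_decomposition A <[v]>,
        ideal A,
        (forall a b, a \in A -> b \in A -> br a b = 0) &
        (forall a, a \in A -> br a v = a)].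

End LeibnizAlgebras.

(* Main.v *)
Require Import Defs.
From mathcomp Require Import all_boot all_order all_algebra.
From mathcomp Require Import all_classical.

Import GRing.Theory.
Local Open Scope ring_scope.

(** The engine of the proof is that dual atomisticity produces ideals.
    Let D be an ideal and let U be a subspace of D containing [D, D].  Then U is
    a subalgebra, hence an intersection of maximal subalgebras M.  If such an M
    contains D, it contains [U, L] and [L, U] because D is an ideal; otherwise
    M + D = L, and both lie in M because M is a subalgebra containing U and
    [D, D].  Hence U is an ideal ([subspace_ideal]).

    For an abelian ideal A this makes every line of A an ideal, so each element
    of L acts on A from either side as a scalar ([abelian_ideal_scalar]).  The
    two scalars are linked: [x, a] + [a, x] lies in Leib(L), which the left
    action kills, so either A lies in Leib(L) and the left action is zero, or
    the left action is minus the right one ([abelian_ideal_left_right]).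

    Choose A of maximal dimension among abelian ideals.  Then A is its own
    centralizer ([max_abelian_self_centralizing]): otherwise solvability gives
    an ideal D inside the centralizer, not inside A, with [D, D] inside A, and
    for b in D but not in A the space A + Fb is an ideal by the principle above.
    It is abelian because b^2 = 0: a maximal subalgebra M missing b^2 would
    satisfy M + A = L, and the component of b in M has square b^2.

    Since the scalar of the right action is a linear form on L with kernel A,
    either L = A is abelian or L = A + Fv with v acting on A as the identity.
    The two possible left actions then yield the almost abelian Lie algebra and
    the algebra Leib(L) + Fv.

    Conversely, a subalgebra of codimension one is maximal, so it suffices to
    separate each subalgebra S from each x outside S by such a hyperplane.  In
    case (i) every subspace is a subalgebra.  In case (ii) the hyperplanes
    containing v or containing Leib(L) are subalgebras, and they are enough. *)

(** * Spans, hyperplanes and scalar maps *)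

Section LinearAlgebra.
Set Implicit Arguments.
Unset Strict Implicit.
Variables (F : fieldType) (V : vectType F).
Implicit Types (S H A : {vspace V}).

Lemma spanset_ind (A : set V) (P : V -> Prop) :
  P 0 -> (forall c x y, P x -> P y -> P (c *: x + y)) ->
  (forall x, A x -> P x) -> forall x, x \in spanset A -> P x.
Proof.
move=> P0 Plin AP x /spansetP[s [sA]].
elim: s x sA => [|a s IHs] x sA; first by rewrite span_nil memv0 => /eqP->.
rewrite span_cons => /memv_addP[_ /vlineP[c ->] [y ys ->]].
apply: Plin; first by apply/AP/sA; rewrite mem_head.
by apply: IHs => // z zs; apply: sA; rewrite inE zs orbT.
Qed.

Lemma line_complementP S v x : (S + <[v]>)%VS = fullv ->
  exists2 s, s \in S & exists k, x = s + k *: v.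
Proof.
move=> Sv; have: x \in (S + <[v]>)%VS by rewrite Sv memvf.
by case/memv_addP => s sS [_ /vlineP[k ->] ->]; exists s => //; exists k.
Qed.

Lemma line_complement_direct S v : v \notin S -> (S + <[v]>)%VS = fullv ->
  direct_decomposition S <[v]>.
Proof.
move=> vS Sv; split=> //; apply/directv_addP/eqP; rewrite -subv0; apply/subvP => x.
rewrite memv_cap => /andP[xS /vlineP[k xE]].
have [k0|k0] := eqVneq k 0; first by rewrite xE k0 scale0r mem0v.
by case/negP: vS; rewrite -[v]scale1r -(mulVf k0) -scalerA -xE memvZ.
Qed.

(** A complement of S + Fx, enlarged by S, omits only the direction of x. *)
Lemma separating_hyperplane S x : x \notin S ->
  exists H, [/\ (S <= H)%VS, x \notin H & (H + <[x]>)%VS = fullv].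
Proof.
move=> xS; exists (S + (S + <[x]>)^C)%VS; split; first exact: addvSl.
  apply/negP => /memv_addP[s sS [w wW xE]].
  have: w \in ((S + <[x]>) :&: (S + <[x]>)^C)%VS.
    rewrite memv_cap wW andbT.
    have -> : w = - s + x by rewrite xE addrA addNr add0r.
    by rewrite memv_add ?memvN ?memv_line.
  rewrite capv_compl memv0 => /eqP w0.
  by move: xS; rewrite xE w0 addr0 sS.
by rewrite -addvA [(_^C + _)%VS]addvC addvA addv_complf.
Qed.

(** Two independent eigenvectors share their eigenvalue, because their sum is an
    eigenvector as well. *)
Lemma eigen_scalar (f : V -> V) A : linear f ->
  (forall a, a \in A -> f a \in <[a]>%VS) ->
  exists c, forall a, a \in A -> f a = c *: a.
Proof.
move=> lin_f fA; have fD a b : f (a + b) = f a + f b.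
  by rewrite -[a in LHS]scale1r lin_f scale1r.
have [A0|A0] := eqVneq A 0%VS.
  exists 0 => a; rewrite A0 memv0 => /eqP->.
  by rewrite scaler0; apply: (addIr (f 0)); rewrite -fD !add0r.
have nz_a0: vpick A != 0 by rewrite vpick0.
have /vlineP[c fa0] := fA _ (memv_pick A).
exists c => b bA; have /vlineP[d fb] := fA b bA.
have [/vlineP[k bE]|ba0] := boolP (b \in <[vpick A]>%VS).
  have [k0|k0] := eqVneq k 0.
    by rewrite fb bE k0 scale0r !scaler0.
  have f0 : f 0 = 0 by apply: (addIr (f 0)); rewrite -fD !add0r.
  by rewrite bE -[k *: _]addr0 lin_f f0 !addr0 fa0 !scalerA mulrC.
have /vlineP[e] := fA _ (memvD (memv_pick A) bA).
rewrite fD fa0 fb scalerDr => eqe.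
have eqde : (c - e) *: vpick A = (e - d) *: b.
  rewrite !scalerBl; apply/eqP; rewrite subr_eq addrAC eq_sym subr_eq.
  by rewrite [X in _ == X]addrC [X in X == _]addrC -eqe addrC.
have ed : e = d.
  apply/eqP; rewrite -subr_eq0; apply: contraR ba0 => nz.
  by rewrite -[b]scale1r -(mulVf nz) -scalerA -eqde !memvZ ?memv_line.
move/eqP: eqde; rewrite ed subrr scale0r scaler_eq0 (negPf nz_a0) orbF subr_eq0.
by move/eqP->.
Qed.

End LinearAlgebra.

(** * Maximal subalgebras and the ideals they force *)

Section Subalgebras.
Set Implicit Arguments.
Unset Strict Implicit.
Variables (F : fieldType) (L : vectType F) (br : {bilinear L -> L -> L}).
Implicit Types (S H A D U M : {vspace L}).

Lemma dually_atomisticP : dually_atomistic br <->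
  forall S x, subalgebra br S -> x \notin S ->
    exists M, [/\ maximal_subalgebra br M, (S <= M)%VS & x \notin M].
Proof.
split=> [da S x algS xS | sep S algS].
  have [C [maxC SE]] := da S algS.
  have [M [CM xM]] : exists M, C M /\ x \notin M.
    apply: contrapT => noM; move/negP: xS; apply.
    suff: [set` S]%classic x by [].
    rewrite SE => M CM /=; apply: contrapT => /negP xM.
    by apply: noM; exists M.
  exists M; split=> //; first exact: maxC.
  apply/subvP => y yS; have: [set` S]%classic y by [].
  by rewrite SE => /(_ M CM).
exists [set M | maximal_subalgebra br M /\ (S <= M)%VS]%classic.
split=> [M []//|]; apply/seteqP; split=> x /= => [xS M [_ /subvP]|xC].
  exact.
apply: contrapT => /negP xS; have [M [maxM SM /negP xM]] := sep S x algS xS.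
by apply: xM; exact: (xC M).
Qed.

Lemma hyperplane_maximal H x : subalgebra br H -> x \notin H ->
  (H + <[x]>)%VS = fullv -> maximal_subalgebra br H.
Proof.
move=> algH xH Hx; split=> // [HL|S algS HS]; first by rewrite HL memvf in xH.
have [xS|xS] := boolP (x \in S).
  by right; apply/eqP; rewrite eqEsubv subvf -Hx subv_add HS.
left; apply/eqP; rewrite eqEsubv HS andbT; apply/subvP => y yS.
have: y \in (H + <[x]>)%VS by rewrite Hx memvf.
case/memv_addP => h hH [_ /vlineP[c ->] yE].
have [c0|c0] := eqVneq c 0; first by rewrite yE c0 scale0r addr0.
move/negP: xS; case.
have -> : x = c^-1 *: (y - h) by rewrite yE addrC addKr scalerA mulVf ?scale1r.
by rewrite memvZ ?memvB // (subvP HS).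
Qed.

(** It suffices to enlarge S to a subspace T that still misses x and above which
    every subspace is a subalgebra: any hyperplane containing T and missing x is
    then a maximal subalgebra. *)
Lemma dually_atomistic_hyperplane :
  (forall S x, subalgebra br S -> x \notin S ->
     exists T, [/\ (S <= T)%VS, x \notin T &
       forall H, (T <= H)%VS -> subalgebra br H]) ->
  dually_atomistic br.
Proof.
move=> sep; apply/dually_atomisticP => S x algS xS.
have [T [ST xT algT]] := sep S x algS xS.
have [H [TH xH Hx]] := separating_hyperplane xT.
exists H; split=> //; last exact: subv_trans TH.
by apply: hyperplane_maximal Hx => //; exact: algT.
Qed.

Lemma alternating_antisymmetric : (forall x, br x x = 0) ->
  forall x y, br x y = - br y x.
Proof.
move=> sq x y; apply/eqP; rewrite -addr_eq0; apply/eqP.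
by have := sq (x + y); rewrite linearDl !linearDr !sq addr0 add0r.
Qed.

Lemma subalgebra_addv M A : subalgebra br M -> ideal br A -> subalgebra br (M + A)%VS.
Proof.
move=> algM idA _ _ /memv_addP[m mM [a aA ->]] /memv_addP[n nM [b bA ->]].
rewrite linearDl linearDr -addrA memv_add ?algM //.
by rewrite memvD ?(idA m b _).2 ?(idA _ a _).1.
Qed.

Lemma maximal_addv M A : maximal_subalgebra br M -> ideal br A ->
  ~~ (A <= M)%VS -> (M + A)%VS = fullv.
Proof.
case=> algM _ maxM idA AM.
have [MA|//] := maxM _ (subalgebra_addv algM idA) (addvSl M A).
by move: AM; rewrite -MA addvSr.
Qed.

(** If a maximal subalgebra M contains U but not D, then L = M + D; the M-part of
    an element of L maps U into M, and its D-part maps U into [D, D], which lies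
    in U.  So all brackets of U with L belong to every such M. *)
Lemma subspace_ideal D U : dually_atomistic br -> ideal br D -> (U <= D)%VS ->
  (forall a b, a \in D -> b \in D -> br a b \in U) -> ideal br U.
Proof.
move=> /dually_atomisticP sep idD UD brD.
have algU : subalgebra br U by move=> a b /(subvP UD) aD /(subvP UD); exact: brD.
have UsubD u : u \in U -> u \in D by exact: (subvP UD).
move=> x u uU; split; apply: contrapT => /negP /(sep _ _ algU)[M [maxM UM /negP]];
  case; have [DM|DM] := boolP (D <= M)%VS.
- by apply: (subvP DM); have [] := idD x u (UsubD u uU).
- have: x \in (M + D)%VS by rewrite maximal_addv ?memvf.
  case/memv_addP => m mM [d dD ->]; case: maxM => algM _ _.
  rewrite linearDr memvD //; first by apply: algM; rewrite // (subvP UM).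
  by apply: (subvP UM); apply: brD; rewrite // UsubD.
- by apply: (subvP DM); have [] := idD x u (UsubD u uU).
have: x \in (M + D)%VS by rewrite maximal_addv ?memvf.
case/memv_addP => m mM [d dD ->]; case: maxM => algM _ _.
rewrite linearDl memvD //; first by apply: algM; rewrite // (subvP UM).
by apply: (subvP UM); apply: brD; rewrite // UsubD.
Qed.

End Subalgebras.

(** * Ideals of Leibniz algebras *)

Section LeibnizIdeals.
Set Implicit Arguments.
Unset Strict Implicit.
Variables (F : fieldType) (L : vectType F) (br : {bilinear L -> L -> L}).
Hypothesis leib : leibniz_algebra br.
Implicit Types (A B C D U W M : {vspace L}).

Lemma br_derivation x y z : br (br x y) z = br x (br y z) + br (br x z) y.
Proof. by rewrite leib subrK. Qed.

Lemma br_square x y : br x (br y y) = 0.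
Proof. by rewrite leib subrr. Qed.

Lemma square_Leib x : br x x \in Leib br.
Proof. by apply: mem_spanset; exists x. Qed.

Lemma br_Leib x e : e \in Leib br -> br x e = 0.
Proof.
elim/spanset_ind => [|c u w xu xw|_ [y _ <-]]; last exact: br_square.
  exact: linear0r.
by rewrite linearPr /= xu xw scaler0 addr0.
Qed.

Lemma br_sym_Leib x y : br x y + br y x \in Leib br.
Proof.
have -> : br x y + br y x = br (x + y) (x + y) - br x x - br y y.
  rewrite linearDl !linearDr addrAC addrA addrK.
  by rewrite addrC !addrA addNr add0r.
by rewrite !memvB ?square_Leib.
Qed.

Lemma mem_brv U W x y : x \in U -> y \in W -> br x y \in brv br U W.
Proof. by move=> xU yW; apply: mem_spanset; exists x => //; exists y. Qed.

Lemma brv_ideal U : ideal br U -> ideal br (brv br U U).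
Proof.
move=> idU x a; elim/spanset_ind.
- by rewrite linear0l linear0r mem0v.
- move=> c u w [ux xu] [wx xw].
  by rewrite linearPl linearPr /= !memvD ?memvZ.
move=> _ [u uU [w wU <-]]; have [ux xu] := idU x u uU; have [wx xw] := idU x w wU.
by split; [rewrite br_derivation memvD | rewrite leib memvB]; rewrite ?mem_brv.
Qed.

Lemma derived_series_ideal n : ideal br (derived_series br n).
Proof.
elim: n => [|n IHn]; first by move=> x a _; rewrite !memvf.
exact: brv_ideal.
Qed.

Lemma ideal_addv A B : ideal br A -> ideal br B -> ideal br (A + B)%VS.
Proof.
move=> idA idB x _ /memv_addP[a aA [b bB ->]]; rewrite linearDl linearDr.
by have [? ?] := idA x a aA; have [? ?] := idB x b bB; rewrite !memv_add.
Qed.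

Lemma ideal_capv A B : ideal br A -> ideal br B -> ideal br (A :&: B)%VS.
Proof.
move=> idA idB x a /memv_capP[aA aB]; rewrite !memv_cap.
by have [-> ->] := idA x a aA; have [-> ->] := idB x a aB.
Qed.

Definition abelian_on A := forall a b, a \in A -> b \in A -> br a b = 0.

Lemma max_abelian_ideal : exists A, [/\ ideal br A, abelian_on A &
  forall B, ideal br B -> abelian_on B -> (A <= B)%VS -> (B <= A)%VS].
Proof.
pose P n := `[< exists A, [/\ ideal br A, abelian_on A & \dim A = n] >].
have exP : exists n, P n.
  exists (\dim (0%VS : {vspace L})); apply/asboolP; exists 0%VS; split=> //.
    by move=> x a; rewrite memv0 => /eqP->; rewrite linear0l linear0r mem0v.
  by move=> a b; rewrite memv0 => /eqP->; rewrite linear0l.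
have ubP n : P n -> (n <= \dim {:L})%N.
  by move=> /asboolP[A [_ _ <-]]; exact/dimvS/subvf.
case: (ex_maxnP exP ubP) => n /asboolP[A [idA abA dA]] maxn.
exists A; split=> // B idB abB AB; have /eqP -> // : A == B.
rewrite -dimv_leqif_eq // eqn_leq dimvS //= dA.
by apply: maxn; apply/asboolP; exists B.
Qed.

Definition centralizer A : {vspace L} :=
  spanset [set x | forall a, a \in A -> br a x = 0 /\ br x a = 0]%classic.

Lemma centralizerP A x : x \in centralizer A <->
  forall a, a \in A -> br a x = 0 /\ br x a = 0.
Proof.
split=> [|xA]; last exact: mem_spanset.
elim/spanset_ind=> // [a _|c u w uA wA a aA].
  by rewrite linear0l linear0r.
have [au ua] := uA a aA; have [aw wa] := wA a aA.
by rewrite linearPl linearPr /= au ua aw wa scaler0 addr0.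
Qed.

Lemma centralizer_ideal A : ideal br A -> ideal br (centralizer A).
Proof.
move=> idA x c /centralizerP cA; split; apply/centralizerP => a aA.
- have [ac ca] := cA a aA; have [/cA[ax_c _] /cA[_ c_xa]] := idA x a aA.
  by rewrite leib ac ax_c br_derivation c_xa ca linear0l subr0 addr0.
have [ac ca] := cA a aA; have [/cA[ax_c _] /cA[xa_c _]] := idA x a aA.
by rewrite leib ac ax_c br_derivation ca xa_c linear0l linear0r subr0 addr0.
Qed.

(** The last term of the derived series whose intersection with C is not inside
    A provides D; this plays the role of an abelian ideal of L/A inside C/A. *)
Lemma solvable_abelian_section A C : solvable_algebra br -> ideal br C ->
  ~~ (C <= A)%VS ->
  exists D, [/\ ideal br D, (D <= C)%VS, ~~ (D <= A)%VS &
                forall x y, x \in D -> y \in D -> br x y \in A].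
Proof.
move=> [m sol] idC CA.
have ex : exists n, (C :&: derived_series br n <= A)%VS.
  by exists m; rewrite sol capv0 sub0v.
case: (ex_minnP ex) => [[|n]] nA minn; first by rewrite /= capvf (negPf CA) in nA.
exists (C :&: derived_series br n)%VS; split; last 1 first.
- move=> x y /memv_capP[xC xn] /memv_capP[yC yn]; apply: (subvP nA).
  by rewrite memv_cap /= mem_brv // andbT; case: (idC y x xC).
- exact/ideal_capv/derived_series_ideal.
- exact: capvSl.
by apply/negP => /minn; rewrite ltnn.
Qed.

End LeibnizIdeals.

(** * Structure of dually atomistic solvable algebras *)

Section DuallyAtomistic.
Set Implicit Arguments.
Unset Strict Implicit.
Variables (F : fieldType) (L : vectType F) (br : {bilinear L -> L -> L}).
Hypothesis leib : leibniz_algebra br.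
Hypothesis da : dually_atomistic br.
Implicit Types (A B C D U W M : {vspace L}).

(** Otherwise some maximal subalgebra M misses b^2, hence does not contain A, so
    that b = m + a with m in M and a in A.  As b commutes with A, m^2 = b^2, which
    puts b^2 in M. *)
Lemma square_centralizer A b : ideal br A -> abelian_on br A ->
  b \in centralizer br A -> br b b \in A -> br b b = 0.
Proof.
move=> idA abA /centralizerP bA bbA; apply/eqP; rewrite -memv0.
have alg0 : subalgebra br 0%VS.
  by move=> x y; rewrite !memv0 => /eqP-> _; rewrite linear0l.
apply: contrapT => /negP bb0.
have [M [maxM _ /negP]] := (dually_atomisticP br).1 da _ _ alg0 bb0; case.
have [AM|AM] := boolP (A <= M)%VS; first exact: (subvP AM).
have: b \in (M + A)%VS by rewrite (maximal_addv maxM) ?memvf.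
case/memv_addP => m mM [a aA bE]; have [ab ba] := bA a aA.
have -> : br b b = br m m.
  have -> : m = b - a by rewrite bE addrK.
  by rewrite linearBl !linearBr ab ba (abA a a aA aA) !subr0.
by case: maxM => algM _ _; exact: algM.
Qed.

(** An element b of the centralizer outside A, taken in an ideal that is abelian
    modulo A, would enlarge A to the abelian ideal A + Fb. *)
Lemma max_abelian_self_centralizing A : solvable_algebra br ->
  ideal br A -> abelian_on br A ->
  (forall B, ideal br B -> abelian_on br B -> (A <= B)%VS -> (B <= A)%VS) ->
  (centralizer br A <= A)%VS.
Proof.
move=> sol idA abA maxA; apply: contrapT => /negP CA.
have [D [idD DC DA brD]] :=
  solvable_abelian_section leib sol (centralizer_ideal leib idA) CA.
have [b bD bA] := subvPn DA.
have bC : b \in centralizer br A := subvP DC b bD.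
have bb0 : br b b = 0 by apply: square_centralizer bC _ => //; exact: brD.
have cAb := (centralizerP br A b).1 bC.
suff: b \in A by exact/negP.
suff /subvP : (A + <[b]> <= A)%VS by apply; apply: (subvP (addvSr A _)); exact: memv_line.
apply: maxA (addvSl _ _).
  apply: (subspace_ideal da (ideal_addv idA idD)).
    by apply: addvS; rewrite ?subvv // -memvE.
  move=> _ _ /memv_addP[a aA [d dD ->]] /memv_addP[a' a'A [d' d'D ->]].
  apply: (subvP (addvSl _ _)); rewrite linearDl !linearDr.
  have [ad' _] := idA d' a aA; have [_ da'] := idA d a' a'A.
  by rewrite (abA a a') // !memvD ?mem0v // brD.
move=> _ _ /memv_addP[a aA [_ /vlineP[k ->] ->]] /memv_addP[a' a'A [_ /vlineP[k' ->] ->]].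
have [ab ba] := cAb a aA; have [ab' ba'] := cAb a' a'A.
rewrite linearDl !linearDr !linearZl_LR !linearZr_LR /= abA //.
by rewrite ab ba' bb0 !scaler0 !addr0.
Qed.

Lemma abelian_ideal_scalar A x : ideal br A -> abelian_on br A ->
  (exists c, forall a, a \in A -> br a x = c *: a) /\
  (exists c, forall a, a \in A -> br x a = c *: a).
Proof.
move=> idA abA.
have line a : a \in A -> ideal br <[a]>%VS.
  move=> aA; apply: (subspace_ideal da idA); first by rewrite -memvE.
  by move=> b c bA cA; rewrite abA ?mem0v.
split; apply: eigen_scalar.
- by move=> c u w; rewrite linearPl.
- by move=> a /line /(_ x a (memv_line a)) [].
- by move=> c u w; rewrite linearPr.
by move=> a /line /(_ x a (memv_line a)) [].
Qed.

(** If b in A is outside Leib(L), the multiple [x, b] + [b, x] of b lies in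
    Leib(L) only when the left and right scalars of x cancel. *)
Lemma abelian_ideal_left_right A : ideal br A -> abelian_on br A ->
  (forall x a, a \in A -> br x a = 0) \/ (forall x a, a \in A -> br x a = - br a x).
Proof.
move=> idA abA; have [AE|/subvPn[b bA bE]] := boolP (A <= Leib br)%VS.
  by left=> x a /(subvP AE); exact: br_Leib.
right=> x a aA; have [[c rx] [d lx]] := abelian_ideal_scalar x idA abA.
rewrite rx // lx // -scaleNr; congr (_ *: a); apply/eqP; rewrite -addr_eq0.
apply: contraR bE => nz; rewrite -[b]scale1r -(mulVf nz) -scalerA memvZ //.
by rewrite scalerDl -rx // -lx // addrC br_sym_Leib.
Qed.

(** The self-centralizing ideal A is the kernel of the scalar of the right action,
    because the left action vanishes together with the right one.  So A has
    codimension at most one, and v is an element whose scalar is normalized. *)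
Lemma scalar_action_decomposition A : ideal br A -> abelian_on br A ->
  (centralizer br A <= A)%VS ->
  (forall x y, br x y = 0) \/
  exists v : L, [/\ v \notin A, direct_decomposition A <[v]>%VS,
                forall a, a \in A -> br a v = a & br v v \in A].
Proof.
move=> idA abA CA; have lr := abelian_ideal_left_right idA abA.
have inA x : (forall a, a \in A -> br a x = 0) -> x \in A.
  move=> xA; apply: (subvP CA); apply/centralizerP => a aA; split; first exact: xA.
  by case: lr => ->; rewrite ?xA ?oppr0.
have [A1|/subvPn[w _ wA]] := boolP (fullv <= A)%VS.
  by left=> x y; apply: abA; apply: (subvP A1); rewrite memvf.
right; have [[c rw] _] := abelian_ideal_scalar w idA abA.
have c0 : c != 0.
  by apply: contraNneq wA => c0; apply: inA => a aA; rewrite rw // c0 scale0r.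
pose v := c^-1 *: w.
have rv a : a \in A -> br a v = a.
  by move=> aA; rewrite linearZr_LR /= rw // scalerA mulVf ?scale1r.
have vA : v \notin A.
  by apply: contra wA => /(memvZ c); rewrite scalerA mulfV ?scale1r.
clearbody v; have Av : (A + <[v]>)%VS = fullv.
  apply/eqP; rewrite eqEsubv subvf; apply/subvP => x _.
  have [[d rx] _] := abelian_ideal_scalar x idA abA.
  rewrite -[x](subrK (d *: v)) memv_add ?memvZ ?memv_line //.
  by apply: inA => a aA; rewrite linearBr linearZr_LR /= rv // rx // subrr.
exists v; split=> //.
  exact: line_complement_direct.
apply: inA => a _; exact: (br_square leib).
Qed.

Lemma dually_atomistic_structure : solvable_algebra br ->
   (lie_algebra br /\ (abelian_algebra br \/ almost_abelian br)) \/
   (exists v : L,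
      [/\ direct_decomposition (Leib br) <[v]>,
          br v v = 0 &
          forall e, e \in Leib br -> br e v = e]).
Proof.
move=> sol; have [A [idA abA maxA]] := max_abelian_ideal br.
have CA := max_abelian_self_centralizing sol idA abA maxA.
have [ab|[v [vA dAv rv vv]]] := scalar_action_decomposition idA abA CA.
  left; split; last by left.
  by split=> [x|x y z]; rewrite !ab ?addr0.
have decomp x := line_complementP x dAv.1.
have [l0|lN] := abelian_ideal_left_right idA abA; [right|left].
  have LA : Leib br = A.
    apply/eqP; rewrite eqEsubv; apply/andP; split.
      apply: spanset_min => _ [x _ <-]; have [a aA [k ->]] := decomp x.
      rewrite linearDl !linearDr !linearZl_LR !linearZr_LR /= abA // rv // l0 //.
      by rewrite add0r scaler0 add0r memvD ?memvZ.
    apply/subvP => a aA.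
    by rewrite -[a](rv a) // -[br a v]addr0 -(l0 v a aA) br_sym_Leib.
  (* v may have a nonzero square in A; subtracting it kills the square because
     v acts on A as the identity from the right and as zero from the left. *)
  exists (v - br v v); rewrite LA; split.
  - apply: line_complement_direct.
      by apply: contra vA => vvA; rewrite -[v](subrK (br v v)) memvD.
    apply/eqP; rewrite eqEsubv subvf; apply/subvP => x _.
    have [a aA [k ->]] := decomp x.
    rewrite -[v in k *: v](subrK (br v v)) scalerDr addrCA addrC.
    by rewrite memv_add ?memvZ ?memv_line // memvD ?memvZ.
  - by rewrite linearBl !linearBr (l0 v _ vv) (rv _ vv) (abA _ _ vv vv) !subr0 subrr.
  by move=> e eA; rewrite linearBr rv // abA // subr0.
(* v kills every square from the left, but acts as minus the identity on A. *)
have v20 : br v v = 0.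
  by apply/eqP; rewrite -oppr_eq0 -[X in - X](rv _ vv) -lN // br_square.
have sq x : br x x = 0.
  have [a aA [k ->]] := decomp x.
  rewrite linearDl !linearDr !linearZl_LR !linearZr_LR /=.
  rewrite (lN v a aA) (rv a aA) (abA a a aA aA) v20.
  by rewrite !scaler0 addr0 add0r scalerN subrr.
have anti := alternating_antisymmetric sq.
split; last by right; exists A, v; split=> //.
split=> // x y z; rewrite leib (anti y) (anti z (br x y)).
by rewrite (anti z x) linearNl opprK subrK subrr.
Qed.
End DuallyAtomistic.

(** * The listed algebras are dually atomistic *)

Section Converse.
Set Implicit Arguments.
Unset Strict Implicit.
Variables (F : fieldType) (L : vectType F) (br : {bilinear L -> L -> L}).

Lemma all_subspaces_dually_atomistic :
  (forall (U : {vspace L}) x y, x \in U -> y \in U -> br x y \in U) -> dually_atomistic br.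
Proof.
move=> algU; apply: dually_atomistic_hyperplane => S x _ xS.
by exists S; split=> // H _ y z; exact: algU.
Qed.

Lemma abelian_dually_atomistic : abelian_algebra br -> dually_atomistic br.
Proof.
by move=> ab; apply: all_subspaces_dually_atomistic => U x y _ _; rewrite ab mem0v.
Qed.

(** With x = a + kv and y = b + lv one has [x, y] = lx - ky, so that every
    subspace is a subalgebra. *)
Lemma almost_abelian_dually_atomistic :
  (forall x, br x x = 0) -> almost_abelian br -> dually_atomistic br.
Proof.
move=> sq [A [v [[Av _] _ abA rv]]].
apply: all_subspaces_dually_atomistic => U x y.
have anti := alternating_antisymmetric sq.
have [a aA [k ->]] := line_complementP x Av.
have [b bA [l ->]] := line_complementP y Av.
move=> xU yU.
have -> : br (a + k *: v) (b + l *: v) = l *: (a + k *: v) - k *: (b + l *: v).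
  rewrite linearDl !linearDr !linearZl_LR !linearZr_LR /= abA // [br v b]anti sq !rv //.
  rewrite !scaler0 addr0 add0r !scalerDr !scalerA opprD addrACA [l * k]mulrC.
  by rewrite subrr addr0 scalerN.
by rewrite memvB ?memvZ.
Qed.

(** Here [e + kv, f + lv] = le.  Hence every subspace containing v or Leib(L) is a
    subalgebra, whereas a subalgebra S without v lies in Leib(L): the square of
    e + kv is ke, so k <> 0 would put e, and then v, in S.  In that case a point x outside S is
    avoided by S + Fv if x lies in Leib(L), and by Leib(L) otherwise. *)
Lemma Leib_split_dually_atomistic v : leibniz_algebra br ->
  direct_decomposition (Leib br) <[v]>%VS -> br v v = 0 ->
  (forall e, e \in Leib br -> br e v = e) -> dually_atomistic br.
Proof.
move=> leib [Ev /directv_addP dEv] v20 rv.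
have decomp x := line_complementP x Ev.
have prodE e k f l : e \in Leib br -> f \in Leib br ->
    br (e + k *: v) (f + l *: v) = l *: e.
  move=> eE fE; rewrite linearDl !linearDr !linearZl_LR !linearZr_LR /=.
  by rewrite !(br_Leib leib _ fE) v20 rv // !scaler0 add0r !addr0.
have algv (H : {vspace L}) : v \in H -> subalgebra br H.
  move=> vH x y xH _; have [e eE [k xE]] := decomp x; have [f fE [l ->]] := decomp y.
  rewrite xE prodE // memvZ //.
  by rewrite -[e](addrK (k *: v)) -xE memvB ?memvZ.
apply: dually_atomistic_hyperplane => S x algS xS.
have [vS|vS] := boolP (v \in S).
  by exists S; split=> // H SH; apply: algv; exact: (subvP SH).
have SE : (S <= Leib br)%VS.
  apply/subvP => y yS; have [e eE [k yE]] := decomp y.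
  have [k0|k0] := eqVneq k 0; first by rewrite yE k0 scale0r addr0.
  have eS : e \in S.
    have := algS y y yS yS; rewrite yE prodE // => /(memvZ k^-1).
    by rewrite scalerA mulVf ?scale1r.
  case/negP: vS; have -> : v = k^-1 *: (y - e).
    by rewrite yE addrC addKr scalerA mulVf ?scale1r.
  by rewrite memvZ ?memvB.
have [xE|xE] := boolP (x \in Leib br); last first.
  exists (Leib br); split=> // H EH y z _ _; apply: (subvP EH).
  have [e eE [k ->]] := decomp y; have [f fE [l ->]] := decomp z.
  by rewrite prodE ?memvZ.
exists (S + <[v]>)%VS; split; first exact: addvSl.
  apply: contra xS => /memv_addP[s sS [w wv xE']].
  suff /eqP w0 : w == 0 by rewrite xE' w0 addr0.
  rewrite -memv0 -dEv memv_cap wv andbT.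
  have -> : w = x - s by rewrite xE' addrC addKr.
  by rewrite memvB // (subvP SE).
by move=> H SvH; apply: algv; apply: (subvP SvH); apply: (subvP (addvSr S _)); exact: memv_line.
Qed.
End Converse.

Theorem proposition3p2 (F : fieldType) (L : vectType F)
    (br : {bilinear L -> L -> L}) :
  leibniz_algebra br -> solvable_algebra br ->
  (dually_atomistic br <->
   (lie_algebra br /\ (abelian_algebra br \/ almost_abelian br)) \/
   (exists v : L,
      [/\ direct_decomposition (Leib br) <[v]>,
          br v v = 0 &
          forall e, e \in Leib br -> br e v = e])).
Proof.
move=> leib sol; split=> [da|]; first exact: dually_atomistic_structure.
case=> [[[sq _] [ab|aab]]|[v [dLv v20 rv]]].
- exact: abelian_dually_atomistic.
- exact: almost_abelian_dually_atomistic.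
exact: Leib_split_dually_atomistic dLv v20 rv.
Qed.
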